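(* Let $\mathbf{x}^*\in\mathbb{R}^{2n}$ be the minimal positive solution of $\mathbf{f}(\mathbf{x})=\mathbf{0}$, and let $\{\mathbf{x}_k\},\{\mathbf{y}_k\},\{\mathbf{z}_k\}$ be the sequences generated by the two-step modified Newton method from an initial guess $\mathbf{x}_0\in\mathbb{R}^{2n}$. If $\mathbf{0}\le\mathbf{x}_0<\mathbf{x}^*$ and $\mathbf{f}(\mathbf{x}_0)<\mathbf{0}$, then the sequences $\{\mathbf{x}_k\},\{\mathbf{y}_k\},\{\mathbf{z}_k\}$ are well-defined and the following statements hold: (i) $\mathbf{f}(\mathbf{x}_k)<\mathbf{0}$, $\mathbf{f}'(\mathbf{z}_k)$ is a nonsingular $M$-matrix, and $\mathbf{f}'(\mathbf{z}_k)^{-1}>0$ for all $k\ge 0$. (ii) $\mathbf{0}\le\mathbf{x}_k<\mathbf{z}_k<\mathbf{y}_k<\mathbf{x}_{k+1}<\mathbf{x}^*$ for all $k\ge0$. (iii) $\lim_{k\to\infty}\mathbf{x}_k=\lim_{k\to\infty}\mathbf{y}_k=\lim_{k\to\infty}\mathbf{z}_k=\mathbf{x}^*$.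
   Context: Data. Let $n\ge1$, $c\in(0,1]$, $\alpha\in[0,1)$. Let $\{\omega_i\}_{i=1}^n$ and $\{c_i\}_{i=1}^n$ be the Gauss-Legendre nodes and weights on $[0,1]$, with $0<\omega_n<\cdots<\omega_1<1$, $c_i>0$, $\sum_{i=1}^n c_i=1$. Put $\delta_i=\frac{1}{c\omega_i(1+\alpha)}$, $\gamma_i=\frac{1}{c\omega_i(1-\alpha)}$, $q_i=\frac{c_i}{2\omega_i}$, $P=\left(\frac{q_j}{\delta_i+\gamma_j}\right)_{n\times n}$, $\widetilde P=\left(\frac{q_j}{\gamma_i+\delta_j}\right)_{n\times n}$, and let $\mathbf{e}=(1,\dots,1)^\top\in\mathbb{R}^n$. With $\circ$ the componentwise (Hadamard) product, define for $\mathbf{x}=[\mathbf{u}^\top,\mathbf{v}^\top]^\top$, $\mathbf{u},\mathbf{v}\in\mathbb{R}^n$, $$\mathbf{f}(\mathbf{x})=\begin{bmatrix}\mathbf{u}-\mathbf{u}\circ(P\mathbf{v})-\mathbf{e}\\ \mathbf{v}-\mathbf{v}\circ(\widetilde P\mathbf{u})-\mathbf{e}\end{bmatrix}\in\mathbb{R}^{2n}.$$ $\mathbf{f}'(\mathbf{x})$ is the Jacobian matrix of $\mathbf{f}$ at $\mathbf{x}$. Inequalities $\le,<$ (and $\geq, >$) between vectors or matrices are entrywise; in particular $\mathbf{a}<\mathbf{b}$ means strict inequality in every component. $\mathbf{x}^*$ denotes the minimal positive solution of $\mathbf{f}(\mathbf{x})=\mathbf{0}$: the positive solution which is entrywise $\le$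 every positive solution (its existence is known). A $Z$-matrix (real square matrix with nonpositive off-diagonal entries) written as $sI-B$ with $B\ge0$ is a nonsingular $M$-matrix if $s>\rho(B)$, where $\rho$ is the spectral radius. Two-step modified Newton method: given $\mathbf{x}_0$, set $\mathbf{z}_{-1}=\mathbf{x}_0$ and for $k=0,1,2,\dots$ $$\mathbf{y}_k=\mathbf{x}_k-\mathbf{f}'(\mathbf{z}_{k-1})^{-1}\mathbf{f}(\mathbf{x}_k),\qquad \mathbf{z}_k=\tfrac12(\mathbf{x}_k+\mathbf{y}_k),\qquad \mathbf{x}_{k+1}=\mathbf{x}_k-\mathbf{f}'(\mathbf{z}_k)^{-1}\mathbf{f}(\mathbf{x}_k).$$ Well-defined means that all the inverses involved exist. *)

(* Defs.v *)
From HB Require Import structures.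
From mathcomp Require Import all_boot all_order all_algebra.
From mathcomp.real_closed Require Import complex.
From mathcomp Require Import all_classical all_reals all_analysis.
Import Order.TTheory GRing.Theory Num.Theory.
Import numFieldNormedType.Exports.

Set Implicit Arguments.
Unset Strict Implicit.
Unset Printing Implicit Defensive.

Local Open Scope classical_set_scope.
Local Open Scope ring_scope.

Section Matrices.
Variable R : realType.

Definition mx_le m n (A B : 'M[R]_(m, n)) : Prop := forall i j, A i j <= B i j.
Definition mx_lt m n (A B : 'M[R]_(m, n)) : Prop := forall i j, A i j < B i j.

Definition hadamard m n (A B : 'M[R]_(m, n)) : 'M[R]_(m, n) := map2_mx *%R A B.

(* The library Jacobian ['J] is for maps between row vectors and acts on the
   right ([deriveEjacobian]), so it is the transpose of the usual one. *)
Definition jacobian_col m n (F : 'cV[R]_n -> 'cV[R]_m) (x : 'cV[R]_n) :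
    'M[R]_(m, n) :=
  ('J (fun y : 'rV[R]_n => (F y^T)^T) (x^T))^T.

(* The maximum of the moduli of the complex eigenvalues. It is written as a
   supremum; the set is finite, and it is nonempty as soon as [0 < n]. *)
Definition spectral_radius n (B : 'M[R]_n) : R :=
  sup [set ComplexField.Normc.normc l | l in
    [set l : complex R |
      eigenvalue (map_mx (real_complex R) B) l]].

Definition Z_matrix n (A : 'M[R]_n) : Prop :=
  forall i j, i != j -> A i j <= 0.

Definition nonsingular_M_matrix n (A : 'M[R]_n) : Prop :=
  Z_matrix A /\
  exists (s : R) (B : 'M[R]_n),
    [/\ mx_le 0 B, A = s%:M - B & spectral_radius B < s].

End Matrices.

Section GaussLegendre.
Variable R : realType.

(* Rodrigues' formula, on [-1, 1]. *)
Definition legendre (n : nat) : {poly R} :=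
  (2 ^+ n * n`!%:R)^-1 *: (('X^2 - 1) ^+ n)^`(n).

(* The nodes are the [n] roots of the Legendre polynomial moved to [0, 1], and
   the weights are the integrals of the Lagrange basis polynomials. *)
Definition gauss_legendre (n : nat) (omega wt : 'I_n -> R) : Prop :=
  [/\ forall i j : 'I_n, (i < j)%N -> omega j < omega i,
      forall i, 0 < omega i < 1,
      forall i, root (legendre n) (2 * omega i - 1) &
      forall i, wt i = Rintegral (@lebesgue_measure R) `[0, 1]
        (fun t : R => \prod_(j < n | j != i)
           ((t - omega j) / (omega i - omega j)))].

End GaussLegendre.

Section Equation.
Variables (R : realType) (n : nat) (c alpha : R) (omega wt : 'I_n -> R).

Definition delta (i : 'I_n) : R := (c * omega i * (1 + alpha))^-1.
Definition gamma (i : 'I_n) : R := (c * omega i * (1 - alpha))^-1.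
Definition q (i : 'I_n) : R := wt i / (2 * omega i).

Definition P : 'M[R]_n := \matrix_(i, j) (q j / (delta i + gamma j)).
Definition Pt : 'M[R]_n := \matrix_(i, j) (q j / (gamma i + delta j)).

Definition f (x : 'cV[R]_(n + n)) : 'cV[R]_(n + n) :=
  let u := usubmx x in
  let v := dsubmx x in
  col_mx (u - hadamard u (P *m v) - const_mx 1)
         (v - hadamard v (Pt *m u) - const_mx 1).

Definition positive_solution (x : 'cV[R]_(n + n)) : Prop :=
  mx_lt 0 x /\ f x = 0.

Definition minimal_positive_solution (x : 'cV[R]_(n + n)) : Prop :=
  positive_solution x /\ forall y, positive_solution y -> mx_le x y.

End Equation.

(* Only [F]'s Jacobians at [newton_zprev k] and [newton_z k] are inverted;
   [invmx] is total, so the iteration has its intended meaning exactly when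
   [newton_well_defined] holds. *)
Section TwoStepNewton.
Variables (R : realType) (m : nat) (F : 'cV[R]_m -> 'cV[R]_m) (x0 : 'cV[R]_m).

Definition half_step (x zprev : 'cV[R]_m) : 'cV[R]_m :=
  x - invmx (jacobian_col F zprev) *m F x.
Definition midpoint (x y : 'cV[R]_m) : 'cV[R]_m := 2^-1 *: (x + y).

(* The pair (x_k, z_{k-1}), with z_{-1} = x_0. *)
Fixpoint newton_state (k : nat) : 'cV[R]_m * 'cV[R]_m :=
  if k is k'.+1 then
    let: (x, zprev) := newton_state k' in
    let z := midpoint x (half_step x zprev) in
    (x - invmx (jacobian_col F z) *m F x, z)
  else (x0, x0).

Definition newton_x (k : nat) : 'cV[R]_m := (newton_state k).1.
Definition newton_zprev (k : nat) : 'cV[R]_m := (newton_state k).2.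
Definition newton_y (k : nat) : 'cV[R]_m :=
  half_step (newton_x k) (newton_zprev k).
Definition newton_z (k : nat) : 'cV[R]_m := midpoint (newton_x k) (newton_y k).

Definition newton_well_defined : Prop :=
  forall k, jacobian_col F (newton_zprev k) \in unitmx /\
            jacobian_col F (newton_z k) \in unitmx.

End TwoStepNewton.

(* Main.v *)
Require Import Defs.
From HB Require Import structures.
From mathcomp Require Import all_boot all_order all_algebra.
From mathcomp.real_closed Require Import complex.
From mathcomp Require Import all_classical all_reals all_analysis.
From mathcomp Require Import ring.
Set Implicit Arguments.
Unset Strict Implicit.
Unset Printing Implicit Defensive.
Import Order.TTheory GRing.Theory Num.Theory.
Import numFieldNormedType.Exports.
Local Open Scope classical_set_scope.
Local Open Scope ring_scope.

(* Write [f x = x - x o (M x) - e] with [M = [[0, P], [Pt, 0]] >= 0], and let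
   [S(a, b) = a o (M b) + b o (M a)], so that [f'(x) h = h - S(x, h)] and the
   second order expansion of [f] is exact. Put [d = x* - x_k], [s = y_k - x_k],
   [s' = x_{k+1} - x_k], [z' = z_{k-1}], [z = z_k] and [x = x_k]. Then
     f'(z') d        = - f(x) + S(d, d) / 2 + S(x - z', d)
     f'(z') (d - s)  = S(d, d) / 2 + S(x - z', d)
     f'(z) d         = - f(x) + S(d, d - s) / 2
     f'(z) (s' - s)  = S(z - z', s)
     f'(z) (d - s')  = S(d, d - s) / 2
     - f(x_{k+1})    = S(s', s' - s) / 2.
   A Z-matrix mapping some positive vector to a positive vector is a nonsingular
   M-matrix whose inverse preserves positivity, so by induction on [k] these
   right-hand sides are all positive, which gives (i) and (ii). Minimality of
   [x*] is used only to identify the limit of the increasing sequence [x_k],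
   which is a positive solution by the identity [f(x) = - f'(z) s']. *)

(** * Matrices [1 - B] with [B >= 0] *)

Lemma mx_le0P (R : realType) (m n : nat) (A : 'M[R]_(m, n)) :
  mx_le 0 A <-> forall i j, 0 <= A i j.
Proof. by split=> A0 i j; have := A0 i j; rewrite mxE. Qed.

Lemma mx_lt0P (R : realType) (m n : nat) (A : 'M[R]_(m, n)) :
  mx_lt 0 A <-> forall i j, 0 < A i j.
Proof. by split=> A0 i j; have := A0 i j; rewrite mxE. Qed.

Lemma mx_ltW (R : realType) (m n : nat) (A B : 'M[R]_(m, n)) :
  mx_lt A B -> mx_le A B.
Proof. by move=> AB i j; exact/ltW/AB. Qed.

Lemma mx_subr_gt0 (R : realType) (m n : nat) (A B : 'M[R]_(m, n)) :
  mx_lt 0 (B - A) <-> mx_lt A B.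
Proof.
split=> [/mx_lt0P|] AB; last apply/mx_lt0P; move=> i j; have := AB i j.
  by rewrite !mxE subr_gt0.
by rewrite !mxE subr_gt0.
Qed.

Lemma mx_subr_ge0 (R : realType) (m n : nat) (A B : 'M[R]_(m, n)) :
  mx_le 0 (B - A) <-> mx_le A B.
Proof.
split=> [/mx_le0P|] AB; last apply/mx_le0P; move=> i j; have := AB i j.
  by rewrite !mxE subr_ge0.
by rewrite !mxE subr_ge0.
Qed.

Section OneMinusNonnegative.
Context {R : realType} {m : nat}.
Variables (B : 'M[R]_m) (h : 'cV[R]_m).
Hypotheses (B_ge0 : mx_le 0 B) (h_gt0 : mx_lt 0 h).
Hypothesis Bh_lt : mx_lt 0 ((1%:M - B) *m h).

Let B0 i j : 0 <= B i j. Proof. by have /mx_le0P := B_ge0; apply. Qed.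
Let h0 i j : 0 < h i j. Proof. by have /mx_lt0P := h_gt0; apply. Qed.
Let Bh_lt_h i : (B *m h) i 0 < h i 0.
Proof.
have /mx_lt0P/(_ i 0) := Bh_lt.
by rewrite mulmxBl mul1mx !mxE subr_gt0.
Qed.

Lemma contraction_factor :
  exists2 t, 0 <= t < 1 & mx_le (B *m h) (t *: h).
Proof.
(* The largest of the ratios (B h)_i / h_i, each of which is below 1. The default value 0 makes [t]
   nonnegative even when there are no indices. *)
exists (\big[Num.max/0]_i ((B *m h) i 0 / h i 0)).
  apply/andP; split; first exact: bigmax_ge_id.
  apply/bigmax_ltP; split=> // i _.
  by rewrite ltr_pdivrMr // mul1r.
move=> i j; rewrite (ord1 j) [leRHS]mxE -ler_pdivrMr //.
exact: (le_bigmax 0 (fun i => (B *m h) i 0 / h i 0)).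
Qed.

(* Pairing a nonnegative left subinvariant vector [w] with [h] bounds its
   growth rate [r]. *)
Lemma left_subinvariant_le (t r : R) (w : 'I_m -> R) :
  mx_le (B *m h) (t *: h) -> (forall i, 0 <= w i) -> (exists i, w i != 0) ->
  (forall j, r * w j <= \sum_i w i * B i j) -> r <= t.
Proof.
move=> Bht w0 [i0 wi0] rw.
have wh : 0 < \sum_j w j * h j 0.
  rewrite (bigD1 i0) //=; apply: ltr_pwDl.
    by rewrite mulr_gt0 // lt_neqAle eq_sym wi0 w0.
  by apply: sumr_ge0 => j _; rewrite mulr_ge0 // ltW.
rewrite -(ler_pM2r wh) !mulr_sumr.
apply: (@le_trans _ _ (\sum_j (\sum_i w i * B i j) * h j 0)).
  by apply: ler_sum => j _; rewrite mulrA ler_pM2r.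
under eq_bigr do rewrite mulr_suml.
rewrite exchange_big /=; apply: ler_sum => i _.
have := Bht i 0; rewrite [leRHS]mxE => Bi.
rewrite mulrCA; apply: le_trans (ler_wpM2l (w0 i) Bi).
by rewrite mxE mulr_sumr; under eq_bigr do rewrite -mulrA.
Qed.

(** Taking moduli in l v = v B turns a left eigenvector [v] into a nonnegative left subinvariant
    vector with growth rate |l|, so |l| <= t. The bound [t] is common to all eigenvalues, hence the
    supremum also stays strictly below 1. *)
Lemma spectral_radius_lt1 : spectral_radius B < 1.
Proof.
have [t /andP[t0 t1] Bht] := contraction_factor.
suff : spectral_radius B <= t by move/le_lt_trans; apply.
rewrite /spectral_radius; set S := (X in sup X).
have ubS : ubound S t.
  move=> _ [l /eigenvalueP[v vl v0] <-].
  pose w i := ComplexField.Normc.normc (v 0 i).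
  apply: (left_subinvariant_le (w := w) Bht).
  - move=> i; rewrite /w /ComplexField.Normc.normc; case: (v 0 i) => a b.
    exact: sqrtr_ge0.
  - apply: contrapT => /forallNP w0; move/eqP: v0; apply; apply/rowP => i.
    have /negP := w0 i; rewrite negbK mxE => /eqP.
    exact: ComplexField.Normc.eq0_normc.
  - move=> j; rewrite /w -ComplexField.Normc.normcM.
    have -> : l * v 0 j = \sum_i v 0 i * (real_complex R (B i j)).
      have /rowP/(_ j) := vl; rewrite !mxE => <-.
      by apply: eq_bigr => i _; rewrite mxE.
    elim/big_ind2: _ => [|x1 x2 y1 y2 le1 le2|i _].
    + by rewrite ComplexField.Normc.normc0.
    + by apply: le_trans (lerD le1 le2); exact: le_normcD.
    + rewrite ComplexField.Normc.normcM ler_wpM2l //.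
        rewrite /ComplexField.Normc.normc; case: (v 0 i) => a b.
        exact: sqrtr_ge0.
      by rewrite /= expr0n /= addr0 sqrtr_sqr ger0_norm.
(* The set of moduli is empty when the dimension is 0; its supremum is then 0 by convention. *)
have [->|/set0P S0] := eqVneq S set0; first by rewrite sup0.
exact: ge_sup.
Qed.

(** A row [v] in the kernel satisfies v = v B, so |v| is left subinvariant with growth rate 1. If
    [v] were nonzero, this would force 1 <= t. *)
Lemma oneB_unitmx : 1%:M - B \in unitmx.
Proof.
have [t /andP[t0 t1] Bht] := contraction_factor.
rewrite -row_free_unit -kermx_eq0; apply/eqP/row_matrixP => i; rewrite row0.
have : row i (kermx (1%:M - B)) *m (1%:M - B) = 0.
  by rewrite -row_mul mulmx_ker row0.
move: (row i _) => v /eqP; rewrite mulmxBr mulmx1 subr_eq0 => /eqP vB.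
apply: contrapT => v0; move: t1; rewrite ltNge => /negP; apply.
apply: (left_subinvariant_le (w := fun i => `|v 0 i|) Bht) => //.
  apply: contrapT => /forallNP w0; apply: v0; apply/rowP => j.
  by have /negP := w0 j; rewrite negbK mxE normr_eq0 => /eqP.
move=> j; rewrite mul1r {1}vB mxE; apply: le_trans (ler_norm_sum _ _ _) _.
by apply: ler_sum => k _; rewrite normrM (ger0_norm (B0 _ _)).
Qed.

(* Look at a row where [w / h] is minimal. *)
Lemma oneB_monotone (w : 'cV[R]_m) :
  mx_le 0 ((1%:M - B) *m w) -> mx_le 0 w.
Proof.
move=> /mx_le0P Aw; apply/mx_le0P => k j; rewrite (ord1 j) {j}.
have [i _ imin] := @arg_minP _ _ _ k xpredT (fun i => w i 0 / h i 0) isT.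
set s := w i 0 / h i 0 in imin.
have wi : w i 0 = s * h i 0 by rewrite /s divfK // gt_eqF.
have wj j : s * h j 0 <= w j 0 by rewrite -ler_pdivlMr // imin.
suff s0 : 0 <= s by apply: le_trans (wj k); rewrite mulr_ge0 // ltW.
(* In the minimizing row, w_i = s h_i while w >= s h elsewhere, so ((1 - B) w)_i <= s ((1 - B) h)_i,
   which is negative if [s] is. *)
rewrite leNgt; apply/negP => s0; have := Aw i 0; apply/negP; rewrite -ltNge.
have := Bh_lt i 0; rewrite !mulmxBl !mul1mx !mxE => Bhi.
apply: (@le_lt_trans _ _ (s * (h i 0 - \sum_j B i j * h j 0))).
  rewrite mulrBr -wi lerD2l lerN2 mulr_sumr; apply: ler_sum => j _.
  by rewrite mulrCA ler_wpM2l.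
by rewrite nmulr_rlt0.
Qed.

Lemma oneB_strictly_monotone (w : 'cV[R]_m) :
  mx_lt 0 ((1%:M - B) *m w) -> mx_lt 0 w.
Proof.
move=> Aw; have /mx_le0P w0 := oneB_monotone (mx_ltW Aw).
apply/mx_lt0P => i j; rewrite (ord1 j).
have /mx_lt0P/(_ i 0) := Aw; rewrite mulmxBl mul1mx !mxE subr_gt0.
by apply: le_lt_trans; apply: sumr_ge0 => k _; rewrite mulr_ge0.
Qed.

(** Column [j] of the inverse is a nonnegative solution of w = e_j + B w. Hence w_j > 0, and
    positivity passes from w_l to w_k whenever B_kl > 0; every [i] is reached from [j] in at most
    two such passages. *)
Lemma oneB_inv_gt0 :
  (forall i j, i = j \/ 0 < B i j \/ exists2 k, 0 < B i k & 0 < B k j) ->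
  mx_lt 0 (invmx (1%:M - B)).
Proof.
move=> conn; apply/mx_lt0P => i j; pose w := col j (invmx (1%:M - B)).
have Aw : (1%:M - B) *m w = delta_mx j 0.
  by rewrite /w colE mulmxA mulmxV ?oneB_unitmx // mul1mx.
have /mx_le0P w0 : mx_le 0 w.
  by apply: oneB_monotone; apply/mx_le0P => k l; rewrite Aw mxE ler0n.
have wE k : w k 0 = (k == j)%:R + \sum_l B k l * w l 0.
  have /(congr1 (fun M : 'cV[R]_m => M k 0)) := Aw.
  by rewrite mulmxBl mul1mx !mxE eqxx andbT => <-; rewrite subrK.
have step k l : 0 < B k l -> 0 < w l 0 -> 0 < w k 0.
  move=> Bkl wl; rewrite wE ltr_wpDl ?ler0n // (bigD1 l) //=.
  rewrite ltr_pwDl ?mulr_gt0 //; apply: sumr_ge0 => ? _.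
  exact: mulr_ge0.
have wj : 0 < w j 0.
  rewrite wE eqxx ltr_pwDl //; apply: sumr_ge0 => ? _; exact: mulr_ge0.
suff : 0 < w i 0 by rewrite mxE.
case: (conn i j) => [-> //|[/step/(_ wj) //|[k Bik Bkj]]].
exact: step (step _ _ Bkj wj).
Qed.

End OneMinusNonnegative.

(** * The quadratic map and its Jacobian *)

Lemma cvg_mxP (R : realType) (m n : nat) (T : Type) (G : set_system T)
    (FG : Filter G) (A : T -> 'M[R]_(m, n)) (L : 'M[R]_(m, n)) :
  A @ G --> L <-> forall i j, A t i j @[t --> G] --> L i j.
Proof.
split=> [AL i j|AL U [V LV VU]].
  apply: (cvg_comp A (fun M : 'M[R]_(m, n) => M i j) AL).
  exact: coord_continuous.
rewrite /nbhs /=; apply: (filterS (P := fun t => forall i j, V i j (A t i j))).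
  by move=> t At; exact: VU.
by do 2 (apply: filter_forall => ?); exact/AL/LV.
Qed.

Lemma cvg_mulmx (R : realType) (m n p : nat) (T : Type) (G : set_system T)
    (FG : Filter G) (A : T -> 'M[R]_(m, n)) (B : T -> 'M[R]_(n, p))
    (A0 : 'M[R]_(m, n)) (B0 : 'M[R]_(n, p)) :
  A @ G --> A0 -> B @ G --> B0 -> A t *m B t @[t --> G] --> A0 *m B0.
Proof.
move=> /cvg_mxP AG /cvg_mxP BG; apply/cvg_mxP => i j; rewrite mxE.
under eq_fun do rewrite mxE.
by apply: cvg_big => [|k _]; [exact: add_continuous|exact: cvgM].
Qed.

Lemma ler_coord_mx_norm (R : realType) (m n : nat) (A : 'M[R]_(m, n)) i j :
  `|A i j| <= `|A|.
Proof.
rewrite [leRHS]/Num.Def.normr /= mx_normrE.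
exact: (le_bigmax 0 (fun ij => `|A ij.1 ij.2|) (i, j)).
Qed.

Lemma mx_norm_le (R : realType) (m n : nat) (A : 'M[R]_(m, n)) (r : R) :
  0 <= r -> (forall i j, `|A i j| <= r) -> `|A| <= r.
Proof.
move=> r0 Ar; rewrite [leLHS]/Num.Def.normr /= mx_normrE.
by apply: bigmax_le => // -[i j] _ /=.
Qed.

Lemma hadamardE (R : realType) (m n : nat) (A B : 'M[R]_(m, n)) i j :
  hadamard A B i j = A i j * B i j.
Proof. by rewrite mxE. Qed.

Section QuadraticMap.
Context {R : realType} {m : nat}.
Variable M : 'M[R]_m.
Implicit Types a b x h : 'cV[R]_m.

Definition quad x : 'cV[R]_m := x - hadamard x (M *m x) - const_mx 1.

(* The second derivative of [quad] is [- sym]. *)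
Definition sym a b : 'cV[R]_m := hadamard a (M *m b) + hadamard b (M *m a).

(** This is diag(M x) + diag(x) M, the matrix of h |-> [sym x h]. It is nonnegative for x >= 0, so
    [dquad] has the form 1 - B treated above. *)
Definition dquad_defect x : 'M[R]_m := \matrix_(i, j)
  ((i == j)%:R * (M *m x) i 0 + x i 0 * M i j).

Definition dquad x : 'M[R]_m := 1%:M - dquad_defect x.

Lemma dquadE x h : dquad x *m h = h - sym x h.
Proof.
rewrite mulmxBl mul1mx; congr (_ - _); apply/colP => i.
rewrite mxE [RHS]mxE !hadamardE addrC [(M *m h) _ _]mxE mulr_sumr.
under eq_bigr do rewrite mxE mulrDl; rewrite !big_split /=; congr (_ + _).
  rewrite (bigD1 i) //= eqxx mul1r big1 ?addr0 1?mulrC // => j ji.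
  by rewrite eq_sym (negPf ji) !mul0r.
by apply: eq_bigr => j _; rewrite mulrA.
Qed.

Lemma symDr a b b' : sym a (b + b') = sym a b + sym a b'.
Proof. by apply/colP => i; rewrite /sym mulmxDr !mxE; ring. Qed.

Lemma symC a b : sym a b = sym b a.
Proof. by rewrite /sym addrC. Qed.

Lemma symNr a b : sym a (- b) = - sym a b.
Proof. by apply/colP => i; rewrite /sym mulmxN !mxE; ring. Qed.

Lemma symZr a b (k : R) : sym a (k *: b) = k *: sym a b.
Proof. by apply/colP => i; rewrite /sym -scalemxAr !mxE; ring. Qed.

Lemma quadD x h : quad (x + h) = quad x + dquad x *m h - 2^-1 *: sym h h.
Proof.
by rewrite dquadE; apply/colP => i; rewrite /quad /sym mulmxDr !mxE; field.
Qed.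

(** By the exact expansion, the increment differs from its linear part by - h o (M h), which is of
    second order in [h]. The candidate [L] acts on rows from the right, to match the transposition
    in [jacobian_col]. *)
Lemma jacobian_quad x : jacobian_col quad x = dquad x.
Proof.
pose L (v : 'rV[R]_m) : 'rV[R]_m := v *m (dquad x)^T.
have linL : linear L by move=> k u v; rewrite /L mulmxDl scalemxAl.
pose LM := GRing.isLinear.Build _ _ _ _ _ linL.
pose dL : {linear 'rV[R]_m -> 'rV[R]_m} := HB.pack L LM.
rewrite /jacobian_col /jacobian.
suff -> : lin1_mx ('d (fun y : 'rV[R]_m => (quad y^T)^T) (x^T)) = (dquad x)^T.
  exact: trmxK.
suff -> : 'd (fun y : 'rV[R]_m => (quad y^T)^T) (x^T) = dL :> (_ -> _).
  by apply/row_matrixP => i; rewrite rowE mul_rV_lin1 /= /L -rowE.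
apply: diff_unique.
  move=> v; apply: (cvg_mulmx (nbhs_filter v)); first exact: cvg_id.
  exact: cvg_cst.
apply/eqaddoP => /= e e0.
(* [K] dominates every absolute row sum of [M], so the remainder is at most K |v|^2. The divisor K +
   1 is positive even if M = 0. *)
pose K := \sum_i \sum_j `|M i j|.
have K0 : 0 <= K by do 2 (apply: sumr_ge0 => ? _).
have ke0 : 0 < e / (K + 1) by rewrite divr_gt0 // ltr_pwDr.
near=> v.
have vsmall : `|v| <= e / (K + 1).
  near: v; rewrite !near_simpl; exact: nbhs0_le.
rewrite [X in `|X|](_ : _ = - (hadamard v^T (M *m v^T))^T); last first.
  rewrite -[LHS]/((quad (v + x^T)^T)^T - ((quad (x^T)^T)^T + L v)).
  have -> : (v + x^T)^T = x + v^T by rewrite linearD /= trmxK addrC.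
  have -> : L v = (dquad x *m v^T)^T by rewrite trmx_mul trmxK.
  rewrite trmxK quadD /sym; move: (dquad x *m v^T) (quad x) (M *m v^T) => w y b.
  by apply/rowP => i; rewrite !mxE; field.
rewrite normrN; apply: mx_norm_le => [|i j]; first by rewrite mulr_ge0 // ltW.
rewrite mxE hadamardE (ord1 i) mxE normrM mulrC; apply: ler_pM => //.
  rewrite mxE; apply: le_trans (ler_norm_sum _ _ _) _.
  apply: (@le_trans _ _ (K * `|v|)).
    apply: (@le_trans _ _ ((\sum_k `|M j k|) * `|v|)).
      rewrite mulr_suml; apply: ler_sum => k _; rewrite normrM ler_wpM2l //.
      by rewrite mxE ler_coord_mx_norm.
    rewrite ler_wpM2r // /K [leRHS](bigD1 j) //= lerDl.
    by do 2 (apply: sumr_ge0 => ? _).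
  apply: (@le_trans _ _ ((K + 1) * `|v|)); first by rewrite ler_wpM2r // lerDl.
  by rewrite mulrC -ler_pdivlMr // ltr_pwDr.
exact: ler_coord_mx_norm.
Unshelve. all: by end_near.
Qed.
End QuadraticMap.

(** * One step of the iteration *)

Lemma mx_addr_gt0 (R : realType) (m n : nat) (A B : 'M[R]_(m, n)) :
  mx_lt 0 A -> mx_le 0 B -> mx_lt 0 (A + B).
Proof.
move=> /mx_lt0P A0 /mx_le0P B0; apply/mx_lt0P => i j.
by rewrite mxE ltr_pwDl.
Qed.

Lemma mx_scaler_gt0 (R : realType) (m n : nat) (k : R) (A : 'M[R]_(m, n)) :
  0 < k -> mx_lt 0 A -> mx_lt 0 (k *: A).
Proof.
by move=> k0 /mx_lt0P A0; apply/mx_lt0P => i j; rewrite mxE mulr_gt0.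
Qed.

Lemma mx_oppr_gt0 (R : realType) (m n : nat) (A : 'M[R]_(m, n)) :
  mx_lt 0 (- A) <-> mx_lt A 0.
Proof. by have := mx_subr_gt0 A 0; rewrite sub0r. Qed.

Lemma mx_le_trans (R : realType) (m n : nat) (A B C : 'M[R]_(m, n)) :
  mx_le A B -> mx_le B C -> mx_le A C.
Proof. by move=> AB BC i j; exact: le_trans (AB i j) (BC i j). Qed.

Lemma mx_le_lt_trans (R : realType) (m n : nat) (A B C : 'M[R]_(m, n)) :
  mx_le A B -> mx_lt B C -> mx_lt A C.
Proof. by move=> AB BC i j; exact: le_lt_trans (AB i j) (BC i j). Qed.

Lemma mx_lt_trans (R : realType) (m n : nat) (A B C : 'M[R]_(m, n)) :
  mx_lt A B -> mx_lt B C -> mx_lt A C.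
Proof. by move=> /mx_ltW; exact: mx_le_lt_trans. Qed.

Section TwoStepNewtonQuad.
Context {R : realType} {m : nat}.
Variable M : 'M[R]_m.
Hypothesis M_ge0 : mx_le 0 M.
Hypothesis M_conn :
  forall i j, 0 < M i j \/ exists2 k, 0 < M i k & 0 < M k j.
Implicit Types a b d s w x y z : 'cV[R]_m.

Local Notation quad := (quad M).
Local Notation sym := (sym M).
Local Notation dquad := (dquad M).

Let M0 i j : 0 <= M i j. Proof. by have /mx_le0P := M_ge0; apply. Qed.

Lemma sym_ge0 a b : mx_le 0 a -> mx_le 0 b -> mx_le 0 (sym a b).
Proof.
move=> /mx_le0P a0 /mx_le0P b0; apply/mx_le0P => i j; rewrite !mxE.
by rewrite addr_ge0 // mulr_ge0 //; apply: sumr_ge0 => k _; rewrite mulr_ge0.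
Qed.

(** Connecting an index [i] with itself shows that every row of [M] has a positive entry, so [M]
    maps positive vectors to positive vectors. *)
Lemma sym_gt0 a b : mx_lt 0 a -> mx_lt 0 b -> mx_lt 0 (sym a b).
Proof.
move=> /mx_lt0P a0 /mx_lt0P b0; apply/mx_lt0P => i j; rewrite !mxE.
have [k Mik] : exists k, 0 < M i k.
  by case: (M_conn i i) => [Mii|[k Mik _]]; [exists i|exists k].
apply: addr_gt0; apply: mulr_gt0 => //; rewrite (bigD1 k) //=;
  (apply: ltr_pwDl; first exact: mulr_gt0);
  by apply: sumr_ge0 => l _; rewrite mulr_ge0 // ltW.
Qed.

Lemma dquad_defect_ge0 z : mx_le 0 z -> mx_le 0 (dquad_defect M z).
Proof.
move=> /mx_le0P z0; apply/mx_le0P => i j; rewrite !mxE addr_ge0 //.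
  by rewrite mulr_ge0 ?ler0n //; apply: sumr_ge0 => k _; rewrite mulr_ge0.
exact: mulr_ge0.
Qed.

Lemma dquad_M_matrix z d : mx_le 0 z -> mx_lt 0 d -> mx_lt 0 (dquad z *m d) ->
  nonsingular_M_matrix (dquad z).
Proof.
move=> z0 d0 zd; have B0 := dquad_defect_ge0 z0; split.
  move=> i j ij; rewrite /dquad !mxE (negPf ij) /= ?mulr0n mul0r !add0r.
  by rewrite oppr_le0 mulr_ge0 //; have /mx_le0P := z0; apply.
exists 1, (dquad_defect M z); split => //.
exact: spectral_radius_lt1 B0 d0 zd.
Qed.

(** Strict positivity of [z] makes every positive entry of [M] a positive entry of
    [dquad_defect M z], through the term z_i M_ij. The defect thus inherits the paths of length at
    most two. *)
Lemma dquad_inv_gt0 z d : mx_lt 0 z -> mx_lt 0 d -> mx_lt 0 (dquad z *m d) ->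
  mx_lt 0 (invmx (dquad z)).
Proof.
move=> z0 d0 zd; have B0 := dquad_defect_ge0 (mx_ltW z0).
have B_gt0 i j : 0 < M i j -> 0 < dquad_defect M z i j.
  move=> Mij; rewrite mxE ltr_wpDl //; last first.
    by rewrite mulr_gt0 //; have /mx_lt0P := z0; apply.
  rewrite mulr_ge0 ?ler0n // mxE; apply: sumr_ge0 => k _.
  by rewrite mulr_ge0 //; have /mx_le0P := mx_ltW z0; apply.
apply: (oneB_inv_gt0 B0 d0 zd) => i j.
right; case: (M_conn i j) => [/B_gt0|[k /B_gt0 Bik /B_gt0 Bkj]]; first by left.
by right; exists k.
Qed.

(** The Jacobian is affine in its base point, with linear part - [sym]. This moves every identity
    known at [x] to z_{k-1} or z_k. *)
Lemma dquad_shift x z w : dquad z *m w = dquad x *m w + sym (x - z) w.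
Proof.
rewrite !dquadE [sym (x - z) _]symC symDr symNr ![sym w _]symC.
by apply/colP => i; rewrite !mxE; ring.
Qed.

(** * Error and increment equations for a single iteration *)

Section Step.
Variables xs z' x y z x' : 'cV[R]_m.
Hypotheses (xs_sol : quad xs = 0) (z'_ge0 : mx_le 0 z') (z'_le : mx_le z' x).
Hypotheses (x_lt : mx_lt x xs) (quad_lt0 : mx_lt (quad x) 0).

Hypotheses (yE : y = half_step quad x z') (zE : z = midpoint x y).
Hypothesis x'E : x' = x - invmx (jacobian_col quad z) *m quad x.

Let d := xs - x.
Let s := y - x.
Let s' := x' - x.

Let d_gt0 : mx_lt 0 d. Proof. exact/mx_subr_gt0. Qed.

Let nquad_gt0 : mx_lt 0 (- quad x). Proof. exact/mx_oppr_gt0. Qed.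

Let zx_sz : z - x = 2^-1 *: s.
Proof.
by rewrite zE /midpoint /s; apply/matrixP => i j; rewrite !mxE; field.
Qed.

Let half_gt0 : 0 < 2^-1 :> R. Proof. by rewrite invr_gt0 ltr0n. Qed.

(** The expansion [quadD] at [x] with increment [d], whose left-hand side is [quad xs] = 0. *)
Let dquad_x_d : dquad x *m d = - quad x + 2^-1 *: sym d d.
Proof.
have := quadD M x d; rewrite [x + d]addrC subrK xs_sol => /eqP.
by rewrite eq_sym subr_eq0 => /eqP <-; rewrite addKr.
Qed.

Let dquad_z'_d : dquad z' *m d = - quad x + (2^-1 *: sym d d + sym (x - z') d).
Proof. by rewrite (dquad_shift x) dquad_x_d -addrA. Qed.

Let remainder_gt0 : mx_lt 0 (2^-1 *: sym d d + sym (x - z') d).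
Proof.
apply: mx_addr_gt0; first exact/mx_scaler_gt0/sym_gt0.
by apply: sym_ge0; [exact/mx_subr_ge0|exact: mx_ltW].
Qed.

(** The error [d] itself is the positive vector with positive image to which the results on 1 - B
    are applied, here at [z'] and below at [z]. *)
Let dquad_z'_d_gt0 : mx_lt 0 (dquad z' *m d).
Proof. by rewrite dquad_z'_d; apply: mx_addr_gt0 => //; exact: mx_ltW. Qed.

Let mono_z' w : mx_lt 0 (dquad z' *m w) -> mx_lt 0 w.
Proof. exact: oneB_strictly_monotone (dquad_defect_ge0 _) d_gt0 _ w. Qed.

Lemma step_unit_zprev : jacobian_col quad z' \in unitmx.
Proof.
by rewrite jacobian_quad; exact: oneB_unitmx (dquad_defect_ge0 _) d_gt0 _.
Qed.

Let dquad_z'_s : dquad z' *m s = - quad x.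
Proof.
rewrite /s yE /half_step addrAC subrr sub0r mulmxN -jacobian_quad.
by rewrite mulKVmx // step_unit_zprev.
Qed.

Let s_gt0 : mx_lt 0 s. Proof. by apply: mono_z'; rewrite dquad_z'_s. Qed.

Let ds_gt0 : mx_lt 0 (d - s).
Proof.
apply: mono_z'.
by rewrite mulmxBr dquad_z'_d dquad_z'_s addrAC subrr add0r.
Qed.

Let zx_gt0 : mx_lt 0 (z - x).
Proof. by rewrite zx_sz; exact: mx_scaler_gt0. Qed.

(** Here the midpoint matters: x - z = - s / 2, so the shift contributes - S(s, d) / 2, which
    combines with S(d, d) / 2 into S(d, d - s) / 2. *)
Let dquad_z_d : dquad z *m d = - quad x + 2^-1 *: sym d (d - s).
Proof.
rewrite (dquad_shift x) dquad_x_d -addrA; congr (_ + _).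
rewrite symDr -(opprB z) zx_sz symC !symNr symZr.
by apply/colP => i; rewrite !mxE; ring.
Qed.

Let dquad_z_d_gt0 : mx_lt 0 (dquad z *m d).
Proof.
rewrite dquad_z_d; apply: mx_addr_gt0 => //; apply: mx_ltW.
exact/mx_scaler_gt0/sym_gt0.
Qed.

Let z_gt0 : mx_lt 0 z.
Proof.
apply: mx_le_lt_trans z'_ge0 _; apply: mx_le_lt_trans z'_le _.
exact/mx_subr_gt0.
Qed.

Let mono_z w : mx_lt 0 (dquad z *m w) -> mx_lt 0 w.
Proof.
exact: (oneB_strictly_monotone (dquad_defect_ge0 (mx_ltW z_gt0)) d_gt0).
Qed.

Lemma step_M_matrix : nonsingular_M_matrix (jacobian_col quad z).
Proof. by rewrite jacobian_quad; exact: dquad_M_matrix (mx_ltW _) d_gt0 _. Qed.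

Lemma step_inv_gt0 : mx_lt 0 (invmx (jacobian_col quad z)).
Proof. by rewrite jacobian_quad; exact: dquad_inv_gt0 d_gt0 _. Qed.

Lemma step_unit_z : jacobian_col quad z \in unitmx.
Proof.
rewrite jacobian_quad.
exact: (oneB_unitmx (dquad_defect_ge0 (mx_ltW z_gt0)) d_gt0).
Qed.

Lemma step_residual : dquad z *m s' = - quad x.
Proof.
rewrite /s' x'E addrAC subrr sub0r mulmxN -jacobian_quad.
by rewrite mulKVmx // step_unit_z.
Qed.

(** Both substeps solve a linear system with the same right-hand side - f(x). Hence f'(z) (s' - s) =
    (f'(z') - f'(z)) s = S(z - z', s). *)
Let s's_gt0 : mx_lt 0 (s' - s).
Proof.
apply: mono_z; rewrite mulmxBr (etrans step_residual (esym dquad_z'_s)).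
rewrite (dquad_shift z z' s) addrAC subrr add0r; apply: sym_gt0 => //.
exact/mx_subr_gt0/(mx_le_lt_trans z'_le)/mx_subr_gt0.
Qed.

Let s'_gt0 : mx_lt 0 s'.
Proof. by rewrite -(subrK s s'); apply: mx_addr_gt0 => //; exact: mx_ltW. Qed.

Let ds'_gt0 : mx_lt 0 (d - s').
Proof.
apply: mono_z; rewrite mulmxBr step_residual dquad_z_d addrAC subrr add0r.
exact/mx_scaler_gt0/sym_gt0.
Qed.

Lemma step_order : [/\ mx_lt x z, mx_lt z y, mx_lt y x' & mx_lt x' xs].
Proof.
split; apply/mx_subr_gt0 => //.
- suff -> : y - z = 2^-1 *: s by exact: mx_scaler_gt0.
  by rewrite zE /midpoint /s; apply/matrixP => i j; rewrite !mxE; field.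
- suff -> : x' - y = s' - s by [].
  by rewrite /s' /s opprB addrA subrK.
- suff -> : xs - x' = d - s' by [].
  by rewrite /s' /d opprB addrA subrK.
Qed.

(** In the expansion at [x] with increment [s'], the term f(x) is replaced by - f'(z) s'. The
    difference (f'(x) - f'(z)) s' equals S(s, s') / 2 and leaves - S(s', s' - s) / 2. *)
Lemma step_quad_lt0 : mx_lt (quad x') 0.
Proof.
apply/mx_oppr_gt0.
suff -> : - quad x' = 2^-1 *: sym s' (s' - s).
  exact/mx_scaler_gt0/sym_gt0.
have -> : x' = x + s' by rewrite /s' addrC subrK.
rewrite quadD -(opprK (quad x)) -step_residual (dquad_shift x z).
rewrite -(opprB z) zx_sz symC symDr !symNr symZr.
by apply/colP => i; rewrite !mxE; ring.
Qed.

End Step.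

End TwoStepNewtonQuad.

(** * Convergence *)

Lemma cvg_hadamard (R : realType) (m n : nat) (T : Type) (G : set_system T)
    (FG : Filter G) (A B : T -> 'M[R]_(m, n)) (A0 B0 : 'M[R]_(m, n)) :
  A @ G --> A0 -> B @ G --> B0 ->
  hadamard (A t) (B t) @[t --> G] --> hadamard A0 B0.
Proof.
move=> /cvg_mxP AG /cvg_mxP BG; apply/cvg_mxP => i j; rewrite hadamardE.
by under eq_fun do rewrite hadamardE; exact: cvgM.
Qed.

Lemma nondecreasing_cvg_mx (R : realType) (m n : nat)
    (u : nat -> 'M[R]_(m, n)) (U : 'M[R]_(m, n)) :
  (forall k, mx_le (u k) (u k.+1)) -> (forall k, mx_le (u k) U) ->
  exists L, [/\ u @ \oo --> L, forall k, mx_le (u k) L & mx_le L U].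
Proof.
move=> u_incr u_le.
have incr i j : nondecreasing_seq (fun k => u k i j).
  by apply/nondecreasing_seqP => k; exact: u_incr.
have cvgu i j : cvgn (fun k => u k i j).
  apply: nondecreasing_is_cvgn (incr i j) _.
  by exists (U i j) => _ [k _ <-]; exact: u_le.
exists (\matrix_(i, j) limn (fun k => u k i j)); split.
- by apply/cvg_mxP => i j; rewrite mxE; exact: cvgu.
- by move=> k i j; rewrite mxE; exact: nondecreasing_cvgn_le.
- move=> i j; rewrite mxE; apply: limr_le (cvgu i j) _.
  by apply: nearW => k; exact: u_le.
Qed.

Lemma squeeze_cvg_mx (R : realType) (m n : nat) (u v w : nat -> 'M[R]_(m, n))
    (L : 'M[R]_(m, n)) :
  (forall k, mx_le (u k) (v k)) -> (forall k, mx_le (v k) (w k)) ->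
  u @ \oo --> L -> w @ \oo --> L -> v @ \oo --> L.
Proof.
move=> uv vw /cvg_mxP uL /cvg_mxP wL; apply/cvg_mxP => i j.
apply: squeeze_cvgr (uL i j) (wL i j); apply: nearW => k.
by rewrite uv vw.
Qed.

Lemma newton_xS (R : realType) (m : nat) (F : 'cV[R]_m -> 'cV[R]_m) x0 k :
  newton_x F x0 k.+1 = newton_x F x0 k -
    invmx (jacobian_col F (newton_z F x0 k)) *m F (newton_x F x0 k).
Proof.
rewrite /newton_z /newton_y /newton_x /newton_zprev /=.
by case: (newton_state F x0 k).
Qed.

Lemma newton_zprevS (R : realType) (m : nat) (F : 'cV[R]_m -> 'cV[R]_m) x0 k :
  newton_zprev F x0 k.+1 = newton_z F x0 k.
Proof.
rewrite /newton_z /newton_y /newton_x /newton_zprev /=.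
by case: (newton_state F x0 k).
Qed.

Section Convergence.
Context {R : realType} {m : nat}.
Variable M : 'M[R]_m.

Lemma cvg_quad (T : Type) (G : set_system T) (FG : Filter G)
    (a : T -> 'cV[R]_m) (A : 'cV[R]_m) :
  a @ G --> A -> quad M (a t) @[t --> G] --> quad M A.
Proof.
move=> aA; apply: cvgB; last exact: cvg_cst.
apply: cvgB => //; apply: cvg_hadamard => //.
by apply: cvg_mulmx => //; exact: cvg_cst.
Qed.

Lemma cvg_sym (T : Type) (G : set_system T) (FG : Filter G)
    (a b : T -> 'cV[R]_m) (A B : 'cV[R]_m) :
  a @ G --> A -> b @ G --> B -> sym M (a t) (b t) @[t --> G] --> sym M A B.
Proof.
by move=> aA bB; apply: cvgD; apply: cvg_hadamard => //;
  apply: cvg_mulmx => //; exact: cvg_cst.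
Qed.

Hypothesis M_ge0 : mx_le 0 M.
Hypothesis M_conn :
  forall i j, 0 < M i j \/ exists2 k, 0 < M i k & 0 < M k j.
Variables xs x0 : 'cV[R]_m.
Hypothesis xs_sol : quad M xs = 0.
Hypothesis xs_min : forall w, mx_lt 0 w -> quad M w = 0 -> mx_le xs w.
Hypotheses (x0_ge0 : mx_le 0 x0) (x0_lt : mx_lt x0 xs).
Hypothesis quad_x0_lt0 : mx_lt (quad M x0) 0.

Let x := newton_x (quad M) x0.
Let y := newton_y (quad M) x0.
Let z := newton_z (quad M) x0.
Let zprev := newton_zprev (quad M) x0.

(** These are the hypotheses of one step. The comparison of z_{k-1} with x_k is weak because z_{-1}
    = x_0. *)
Lemma newton_invariant k :
  [/\ mx_le 0 (zprev k), mx_le (zprev k) (x k), mx_lt (x k) xs &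
      mx_lt (quad M (x k)) 0].
Proof.
elim: k => [|k [zp0 zpx xxs fx]]; first by split.
have [xz zy yx' x'xs] := step_order M_ge0 M_conn xs_sol zp0 zpx xxs fx
  (erefl (y k)) (erefl (z k)) (newton_xS (quad M) x0 k).
have fx' := step_quad_lt0 M_ge0 M_conn xs_sol zp0 zpx xxs fx
  (erefl (y k)) (erefl (z k)) (newton_xS (quad M) x0 k).
rewrite /zprev newton_zprevS; split => //.
- apply: mx_le_trans zp0 _; apply: mx_le_trans zpx _; exact: mx_ltW.
- exact/mx_ltW/(mx_lt_trans zy).
Qed.

Lemma newton_order k :
  [/\ mx_lt (x k) (z k), mx_lt (z k) (y k), mx_lt (y k) (x k.+1) &
      mx_lt (x k.+1) xs].
Proof.
have [zp0 zpx xxs fx] := newton_invariant k.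
exact: (step_order M_ge0 M_conn xs_sol zp0 zpx xxs fx
  (erefl (y k)) (erefl (z k)) (newton_xS (quad M) x0 k)).
Qed.

(** The residual is written without any inverse Jacobian, so the limit can be taken with no bound on
    the inverses. *)
Lemma newton_residual k :
  quad M (x k) = sym M (z k) (x k.+1 - x k) - (x k.+1 - x k).
Proof.
have [zp0 zpx xxs fx] := newton_invariant k.
have := step_residual M_ge0 M_conn xs_sol zp0 zpx xxs fx
  (erefl (y k)) (erefl (z k)) (newton_xS (quad M) x0 k).
by rewrite dquadE => /(congr1 (-%R)); rewrite opprK opprB => <-.
Qed.

Lemma newton_x_incr k : mx_le (x k) (x k.+1).
Proof.
have [xz zy yx' _] := newton_order k.
exact/mx_ltW/(mx_lt_trans xz)/(mx_lt_trans zy).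
Qed.

Lemma newton_cvg : [/\ x @ \oo --> xs, y @ \oo --> xs & z @ \oo --> xs].
Proof.
have x_lt k : mx_le (x k) xs by have [_ _ /mx_ltW] := newton_invariant k.
have [L [xL x_le L_le]] := nondecreasing_cvg_mx newton_x_incr x_lt.
have xSL : (fun k => x k.+1) @ \oo --> L.
  by have := xL; rewrite -(cvg_shiftS x).
have yL : y @ \oo --> L.
  apply: squeeze_cvg_mx xL xSL => k; have [xz zy yx _] := newton_order k.
    exact/mx_ltW/(mx_lt_trans xz).
  exact: mx_ltW.
have zL : z @ \oo --> L.
  apply: squeeze_cvg_mx xL yL => k; have [xz zy _ _] := newton_order k;
    exact: mx_ltW.
suff -> : xs = L by split.
(* Since x_0 may have zero entries, positivity comes from L >= x_1 > x_0 >= 0. *)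
have L_gt0 : mx_lt 0 L.
  have [xz zy yx _] := newton_order 0%N => i j.
  apply: (le_lt_trans (x0_ge0 i j)); apply: lt_le_trans (x_le 1%N i j).
  exact: (mx_lt_trans xz (mx_lt_trans zy yx)).
have L_sol : quad M L = 0.
  apply: (@cvg_unique _ (@norm_hausdorff _ _) (quad M (x k) @[k --> \oo])).
    exact: cvg_quad.
  (* The increments tend to 0, so the residuals tend to S(L, 0) - 0 = 0. *)
  have dL : (x k.+1 - x k) @[k --> \oo] --> (0 : 'cV[R]_m).
    by rewrite -(subrr L); apply: cvgB.
  have -> : 0 = sym M L 0 - 0.
    by rewrite -(scale0r (0 : 'cV[R]_m)) symZr !scale0r subrr.
  rewrite (funext newton_residual).
  by apply: cvgB => //; exact: cvg_sym.
(* The bound L <= x* comes from the iterates, and x* <= L from minimality. *)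
apply/matrixP => i j; apply/eqP; rewrite eq_le L_le andbT.
exact: xs_min.
Qed.

Lemma two_step_newton_quad :
  [/\ newton_well_defined (quad M) x0,
      (forall k, [/\ mx_lt (quad M (x k)) 0,
                     nonsingular_M_matrix (jacobian_col (quad M) (z k)) &
                     mx_lt 0 (invmx (jacobian_col (quad M) (z k)))]),
      (forall k, [/\ mx_le 0 (x k), mx_lt (x k) (z k), mx_lt (z k) (y k),
                     mx_lt (y k) (x k.+1) & mx_lt (x k.+1) xs]) &
      [/\ x @ \oo --> xs, y @ \oo --> xs & z @ \oo --> xs]].
Proof.
split; last exact: newton_cvg.
- move=> k; have [zp0 zpx xxs fx] := newton_invariant k; split.
    exact: (step_unit_zprev M_ge0 M_conn xs_sol zp0 zpx xxs fx).
  exact: (step_unit_z M_ge0 M_conn xs_sol zp0 zpx xxs fx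
    (erefl (y k)) (erefl (z k))).
- move=> k; have [zp0 zpx xxs fx] := newton_invariant k; split => //.
    exact: (step_M_matrix M_ge0 M_conn xs_sol zp0 zpx xxs fx
      (erefl (y k)) (erefl (z k))).
  exact: (step_inv_gt0 M_ge0 M_conn xs_sol zp0 zpx xxs fx
    (erefl (y k)) (erefl (z k))).
- move=> k; have [zp0 zpx xxs fx] := newton_invariant k.
  have [xz zy yx xs_lt] := newton_order k; split => //.
  exact: mx_le_trans zp0 zpx.
Qed.

End Convergence.

(** * The coupled system *)

Section Coupling.
Context {R : realType} {n : nat}.
Variables (c alpha : R) (omega wt : 'I_n -> R).

Definition coupling : 'M[R]_(n + n) :=
  block_mx 0 (P c alpha omega wt) (Pt c alpha omega wt) 0.

Lemma f_quad : f c alpha omega wt = quad coupling.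
Proof.
apply/funext => x; rewrite -[x]vsubmxK.
move: (usubmx x) (dsubmx x) => u v.
rewrite /f /quad col_mxKu col_mxKd mul_block_col !mul0mx add0r addr0.
by rewrite /hadamard map2_col_mx -col_mx_const !opp_col_mx !add_col_mx.
Qed.

Hypotheses (c_gt0 : 0 < c) (alpha_range : 0 <= alpha < 1).
Hypotheses (omega_gt0 : forall i, 0 < omega i) (wt_gt0 : forall i, 0 < wt i).

Lemma delta_gt0 i : 0 < delta c alpha omega i.
Proof.
case/andP: alpha_range => a0 a1.
by rewrite invr_gt0 mulr_gt0 ?mulr_gt0 // ltr_pwDl.
Qed.

Lemma gamma_gt0 i : 0 < gamma c alpha omega i.
Proof.
case/andP: alpha_range => a0 a1.
by rewrite invr_gt0 mulr_gt0 ?mulr_gt0 // subr_gt0.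
Qed.

Lemma q_gt0 i : 0 < q omega wt i.
Proof. by rewrite divr_gt0 // mulr_gt0. Qed.

Lemma P_gt0 i j : 0 < P c alpha omega wt i j.
Proof. by rewrite mxE divr_gt0 ?q_gt0 // addr_gt0 ?delta_gt0 ?gamma_gt0. Qed.

Lemma Pt_gt0 i j : 0 < Pt c alpha omega wt i j.
Proof. by rewrite mxE divr_gt0 ?q_gt0 // addr_gt0 ?delta_gt0 ?gamma_gt0. Qed.

Lemma coupling_ge0 : mx_le 0 coupling.
Proof.
apply/mx_le0P => i j.
case: (split_ordP i) => k ->; case: (split_ordP j) => l ->.
- by rewrite block_mxEul mxE.
- by rewrite block_mxEur ltW // P_gt0.
- by rewrite block_mxEdl ltW // Pt_gt0.
- by rewrite block_mxEdr mxE.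
Qed.

(** The positive entries form a complete bipartite graph between the two halves of the indices:
    opposite halves are joined directly, and two indices of the same half through any index of the
    other. *)
Lemma coupling_connected i j :
  0 < coupling i j \/ exists2 k, 0 < coupling i k & 0 < coupling k j.
Proof.
case: (split_ordP i) => k ->; case: (split_ordP j) => l ->.
- right; exists (rshift n k); first by rewrite block_mxEur P_gt0.
  by rewrite block_mxEdl Pt_gt0.
- by left; rewrite block_mxEur P_gt0.
- by left; rewrite block_mxEdl Pt_gt0.
- right; exists (lshift n k); first by rewrite block_mxEdl Pt_gt0.
  by rewrite block_mxEur P_gt0.
Qed.

End Coupling.

Theorem theorem4p1 (R : realType) (n : nat) (n_ge1 : (1 <= n)%N)
    (c alpha : R) (c_range : 0 < c <= 1) (alpha_range : 0 <= alpha < 1)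
    (omega wt : 'I_n -> R) (GL : gauss_legendre omega wt)
    (wt_gt0 : forall i, 0 < wt i) (wt_sum : \sum_(i < n) wt i = 1)
    (xstar : 'cV[R]_(n + n))
    (xstarP : minimal_positive_solution c alpha omega wt xstar)
    (x0 : 'cV[R]_(n + n))
    (x0_ge0 : mx_le 0 x0) (x0_lt : mx_lt x0 xstar)
    (fx0_lt0 : mx_lt (f c alpha omega wt x0) 0) :
  let F := f c alpha omega wt in
  let x := newton_x F x0 in
  let y := newton_y F x0 in
  let z := newton_z F x0 in
  [/\ newton_well_defined F x0,
      (forall k, [/\ mx_lt (F (x k)) 0,
                     nonsingular_M_matrix (jacobian_col F (z k)) &
                     mx_lt 0 (invmx (jacobian_col F (z k)))]),
      (forall k, [/\ mx_le 0 (x k), mx_lt (x k) (z k), mx_lt (z k) (y k),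
                     mx_lt (y k) (x k.+1) & mx_lt (x k.+1) xstar]) &
      [/\ x @ \oo --> xstar, y @ \oo --> xstar & z @ \oo --> xstar]].
Proof.
case/andP: c_range => c_gt0 _; case: GL => _ omega_in _ _.
have omega_gt0 i : 0 < omega i by case/andP: (omega_in i).
case: xstarP => -[_ xs_sol] xs_min.
rewrite /positive_solution f_quad in xs_sol xs_min fx0_lt0.
(* [f_quad] is an equality of functions, so it carries over the Jacobians and the whole
   iteration. *)
rewrite f_quad; apply: two_step_newton_quad => //.
- exact: coupling_ge0.
- exact: coupling_connected.
- by move=> w w0 fw; exact: xs_min.
Qed.
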